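(* Let $(X,R)$ be a commutative word rewriting system, with $X$ equipped with a total order. The functor $\pi:\langle G(\Sigma^2(X,R))\rangle\to\langle G(X,R)\rangle$ induces (on the quotients) a functor $\overline{\pi}:\langle\Sigma^2(X,R)\rangle\to\mathcal{G}(X,R)$.
   Context: For a set $X$, $\langle X\rangle$ is the free monoid on $X$ with product $\otimes$, $[X]$ is the free commutative monoid on $X$ written additively, and $\pi:\langle X\rangle\to[X]$ is the canonical projection. For a graph $G$, $\langle G\rangle$ is the free category on $G$ (arrows are finite paths, composition is concatenation). A commutative word rewriting system is a pair $(X,R)$ with $X$ a set and $R$ a family of pairs $\alpha=(s(\alpha),t(\alpha))$ of elements of $[X]$. Its reduction graph $G(X,R)$ has objects the elements of $[X]$ and arrows $c+\alpha$ (pairs with $c\in[X]$, $\alpha\in R$) from $c+s(\alpha)$ to $c+t(\alpha)$. The congruence $\equiv_{(X,R)}$ on $\langle G(X,R)\rangle$ is generated by identifying, for all $\alpha,\beta\in R$, $c\in[X]$, the path ''$(c+s(\beta))+\alpha$ followed by $(c+t(\alpha))+\beta$'' with the path ''$(c+s(\alpha))+\beta$ followed by $(c+t(\beta))+\alpha$''. One puts $\mathcal{G}(X,R)=\langle G(X,R)\rangle/\equiv_{(X,R)}$. When $X$ is totally ordered, each $a\in[X]$ decomposes uniquely as $n_1.x_1+\dots+n_k.x_k$ with $n_i\geq 1$ and $x_1<\dots<x_k$, and $\overline{a}=x_1^{n_1}\cdots x_k^{n_k}\in\langle X\rangle$. The $2$-polygraph $\Sigma^2(X,R)$ has one $0$-cell,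 the elements of $X$ as $1$-cells (so $1$-arrows are the elements of $\langle X\rangle$), and as $2$-cells: one $\tau_{x,y}$ for each $x\neq y$ in $X$, with $s_1(\tau_{x,y})=x\otimes y$, $t_1(\tau_{x,y})=y\otimes x$, and one $\alpha$ for each $\alpha\in R$, with $s_1(\alpha)=\overline{s(\alpha)}$, $t_1(\alpha)=\overline{t(\alpha)}$. Its reduction graph $G(\Sigma^2(X,R))$ has objects the elements of $\langle X\rangle$ and arrows the triples $u\otimes\phi\otimes v$ ($u,v\in\langle X\rangle$, $\phi$ a $2$-cell) from $u\otimes s_1(\phi)\otimes v$ to $u\otimes t_1(\phi)\otimes v$. The functor $\pi:\langle G(\Sigma^2(X,R))\rangle\to\langle G(X,R)\rangle$ is the canonical projection on objects and is determined on generating arrows by $\pi(u\otimes\tau_{x,y}\otimes v)=\mathrm{id}_{\pi(u)+x+y+\pi(v)}$ and $\pi(u\otimes\alpha\otimes v)=\pi(u)+\pi(v)+\alpha$. The free $2$-category $\langle\Sigma^2(X,R)\rangle$ is here regarded as the category whose objects are the $1$-arrows (elements of $\langle X\rangle$) and whose arrows are the $2$-arrows, that is, the paths of $G(\Sigma^2(X,R))$ modulo the congruence $\equiv_{01}$ generated by the exchange relations identifying, for all $2$-cells $\phi,\psi$ and $u,v,w\in\langle X\rangle$, the path ''$u\otimes\phi\otimes(v\otimes s_1(\psi)\otimes w)$ followed by $(u\otimes t_1(\phi)\otimes v)\otimes\psi\otimes w$'' with the path ''$(u\otimes s_1(\phi)\otimes v)\otimes\psi\otimes w$ followed by $u\otimes\phi\otimes(v\otimes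 t_1(\psi)\otimes w)$''. That $\pi$ induces $\overline{\pi}$ means that $\overline{\pi}$ composed with the quotient functor $\langle G(\Sigma^2(X,R))\rangle\to\langle\Sigma^2(X,R)\rangle$ equals $\pi$ followed by the quotient functor $\langle G(X,R)\rangle\to\mathcal{G}(X,R)$. *)

(* Defs.v *)
From mathcomp Require Import all_boot all_order generic_quotient.
From mathcomp Require Import finmap multiset.
From mathcomp Require Import boolp.

Set Implicit Arguments.
Unset Strict Implicit.
Unset Printing Implicit Defensive.

Local Open Scope quotient_scope.
Local Open Scope mset_scope.

(* Composition is written in diagrammatic order, for arrows and for functors:
   [comp f g] is f followed by g, [functor_comp F G] is F followed by G. *)
Record category := Category {
  obj :> Type;
  hom : obj -> obj -> Type;
  idm : forall a, hom a a;
  comp : forall a b c, hom a b -> hom b c -> hom a c;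
  comp1m : forall a b (f : hom a b), comp (idm a) f = f;
  compm1 : forall a b (f : hom a b), comp f (idm b) = f;
  compA : forall a b c d (f : hom a b) (g : hom b c) (h : hom c d),
    comp f (comp g h) = comp (comp f g) h
}.

Arguments hom : clear implicits.
Arguments idm {C} a : rename.
Arguments comp {C a b c} f g : rename.

Record functor (C D : category) := Functor {
  fobj :> C -> D;
  fhom : forall a b, hom C a b -> hom D (fobj a) (fobj b);
  fhom_id : forall a, fhom (idm a) = idm (fobj a);
  fhom_comp : forall a b c (f : hom C a b) (g : hom C b c),
    fhom (comp f g) = comp (fhom f) (fhom g)
}.

Arguments fhom {C D} F {a b} f : rename.

Section FunctorComp.
Variables (C D E : category) (F : functor C D) (G : functor D E).

Fact functor_comp_id (a : C) : fhom G (fhom F (idm a)) = idm (G (F a)).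
Proof. by rewrite !fhom_id. Qed.

Fact functor_comp_comp (a b c : C) (f : hom C a b) (g : hom C b c) :
  fhom G (fhom F (comp f g)) = comp (fhom G (fhom F f)) (fhom G (fhom F g)).
Proof. by rewrite !fhom_comp. Qed.

Definition functor_comp : functor C E :=
  @Functor C E (fun a => G (F a)) (fun a b f => fhom G (fhom F f))
    functor_comp_id functor_comp_comp.

End FunctorComp.

Definition homrel (C : category) :=
  forall a b : C, hom C a b -> hom C a b -> Prop.

Section Quotient.
Variables (C : category) (r : homrel C).

Inductive congruence : homrel C :=
| Cong_gen a b (f g : hom C a b) : r f g -> congruence f g
| Cong_refl a b (f : hom C a b) : congruence f f
| Cong_sym a b (f g : hom C a b) : congruence f g -> congruence g f
| Cong_trans a b (f g h : hom C a b) :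
    congruence f g -> congruence g h -> congruence f h
| Cong_comp a b c (f f' : hom C a b) (g g' : hom C b c) :
    congruence f f' -> congruence g g' ->
    congruence (comp f g) (comp f' g').

(* [{classic T}] equips T with the choice structure required by
   [{eq_quot _}]. *)
Definition congruenceb (a b : C) : rel {classic hom C a b} :=
  fun f g => `[< congruence f g >].

Fact congruenceb_refl a b : reflexive (@congruenceb a b).
Proof. by move=> f; apply/asboolP/Cong_refl. Qed.

Fact congruenceb_sym a b : symmetric (@congruenceb a b).
Proof. by move=> f g; apply/asboolP/asboolP; apply: Cong_sym. Qed.

Fact congruenceb_trans a b : transitive (@congruenceb a b).
Proof.
move=> g f h /asboolP fg /asboolP gh; apply/asboolP; exact: Cong_trans fg gh.
Qed.

Canonical congruence_equiv a b :=
  EquivRel (@congruenceb a b)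
    (@congruenceb_refl a b) (@congruenceb_sym a b) (@congruenceb_trans a b).

Definition quot_hom (a b : C) : Type := {eq_quot (@congruenceb a b)}.

Definition class_of a b (f : hom C a b) : quot_hom a b :=
  \pi_{eq_quot (@congruenceb a b)} (f : {classic hom C a b}).

Definition rep a b (q : quot_hom a b) : hom C a b :=
  repr (q : {eq_quot (@congruenceb a b)}).

Fact class_ofK a b (q : quot_hom a b) : class_of (rep q) = q.
Proof. exact: reprK. Qed.

Fact class_ofP a b (f g : hom C a b) :
  class_of f = class_of g <-> congruence f g.
Proof.
by split=> [/eqmodP/asboolP //|fg]; apply/eqmodP/asboolP.
Qed.

Fact rep_class_of a b (f : hom C a b) : congruence (rep (class_of f)) f.
Proof. by apply/class_ofP; rewrite class_ofK. Qed.

Definition quot_comp a b c (p : quot_hom a b) (q : quot_hom b c) :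
  quot_hom a c := class_of (comp (rep p) (rep q)).

Fact quot_compE a b c (f : hom C a b) (g : hom C b c) :
  class_of (comp f g) = quot_comp (class_of f) (class_of g).
Proof.
by apply/class_ofP/Cong_comp; apply: Cong_sym; apply: rep_class_of.
Qed.

Fact quot_comp1m a b (p : quot_hom a b) : quot_comp (class_of (idm a)) p = p.
Proof. by rewrite -[p]class_ofK -quot_compE comp1m. Qed.

Fact quot_compm1 a b (p : quot_hom a b) : quot_comp p (class_of (idm b)) = p.
Proof. by rewrite -[p]class_ofK -quot_compE compm1. Qed.

Fact quot_compA a b c d
    (p : quot_hom a b) (q : quot_hom b c) (s : quot_hom c d) :
  quot_comp p (quot_comp q s) = quot_comp (quot_comp p q) s.
Proof.
by rewrite -[p]class_ofK -[q]class_ofK -[s]class_ofK -!quot_compE compA.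
Qed.

Definition quotient : category :=
  @Category C quot_hom (fun a => class_of (idm a)) quot_comp
    quot_comp1m quot_compm1 quot_compA.

Definition quotient_functor : functor C quotient :=
  @Functor C quotient id class_of (fun _ => erefl) quot_compE.

End Quotient.

Record graph := Graph {
  vertex : Type;
  edge : Type;
  gsrc : edge -> vertex;
  gtgt : edge -> vertex
}.

Section FreeCategory.
Variable G : graph.

Fixpoint chain (a : vertex G) (s : seq (edge G)) (b : vertex G) : Prop :=
  if s is e :: s' then gsrc e = a /\ chain (gtgt e) s' b else a = b.

(* A path is its list of edges, the endpoints being carried by the type; two
   paths from a to b are equal as soon as these lists are. *)
Definition gpath (a b : vertex G) := {s : seq (edge G) | chain a s b}.

Definition edges a b (p : gpath a b) : seq (edge G) := sval p.

Fact gpath_inj a b (p q : gpath a b) : edges p = edges q -> p = q.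
Proof. by case: p q => s ps [t pt]; apply: eq_exist. Qed.

Fact chain_cat a b c s t : chain a s b -> chain b t c -> chain a (s ++ t) c.
Proof.
by elim: s a => [|e s IHs] a /= => [->|[-> st] tc] //; split=> //; apply: IHs.
Qed.

Definition empty_path a : gpath a a := exist _ [::] erefl.

Definition cat_path a b c (p : gpath a b) (q : gpath b c) : gpath a c :=
  exist _ (edges p ++ edges q) (chain_cat (svalP p) (svalP q)).

Fact cat_path1p a b (p : gpath a b) : cat_path (empty_path a) p = p.
Proof. exact: gpath_inj. Qed.

Fact cat_pathp1 a b (p : gpath a b) : cat_path p (empty_path b) = p.
Proof. by apply: gpath_inj; rewrite /= /edges /= cats0. Qed.

Fact cat_pathA a b c d (p : gpath a b) (q : gpath b c) (s : gpath c d) :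
  cat_path p (cat_path q s) = cat_path (cat_path p q) s.
Proof. by apply: gpath_inj; rewrite /edges /= /edges /= catA. Qed.

Definition free_category : category :=
  @Category (vertex G) gpath empty_path cat_path cat_path1p cat_pathp1
    cat_pathA.

End FreeCategory.

(* The functor between free categories determined by its values on vertices
   and on edges. *)
Section FreeFunctor.
Variables (G H : graph) (F0 : vertex G -> vertex H).
Variable F1 : forall e : edge G, gpath (F0 (gsrc e)) (F0 (gtgt e)).

Definition free_map (s : seq (edge G)) : seq (edge H) :=
  flatten [seq edges (F1 e) | e <- s].

Fact chain_free_map a s b : chain a s b -> chain (F0 a) (free_map s) (F0 b).
Proof.
elim: s a => [|e s IHs] a /= => [->|[<- st]] //.
by apply: (chain_cat (svalP (F1 e))); apply: IHs.
Qed.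

Definition free_hom a b (p : hom (free_category G) a b) :
  hom (free_category H) (F0 a) (F0 b) :=
  exist _ (free_map (edges p)) (chain_free_map (svalP p)).

Fact free_hom_id a : free_hom (idm a) = idm (F0 a : free_category H).
Proof. exact: gpath_inj. Qed.

Fact free_hom_comp a b c
    (p : hom (free_category G) a b) (q : hom (free_category G) b c) :
  free_hom (comp p q) = comp (free_hom p) (free_hom q).
Proof. by apply: gpath_inj; rewrite /edges /= /free_map map_cat flatten_cat. Qed.

Definition free_functor : functor (free_category G) (free_category H) :=
  @Functor (free_category G) (free_category H) F0 free_hom free_hom_id
    free_hom_comp.

End FreeFunctor.

(* The free commutative monoid on X is [{mset X}], with sum [`+`]; the free
   monoid on X is [seq X], with product [++]; the projection from the latter
   to the former is [seq_mset]. *)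

(* The rules form a family: [rule] is its index type, so that distinct rules
   may have the same source and target. *)
Record cwrs (X : choiceType) := Cwrs {
  rule : Type;
  rsrc : rule -> {mset X};
  rtgt : rule -> {mset X}
}.

Section CommutativeReduction.
Variables (X : choiceType) (R : cwrs X).

Definition cwrs_graph : graph :=
  @Graph {mset X} ({mset X} * rule R)
    (fun e => e.1 `+` rsrc e.2) (fun e => e.1 `+` rtgt e.2).

Definition cwrs_exchange : homrel (free_category cwrs_graph) :=
  fun a b p q => exists (c : {mset X}) (alpha beta : rule R),
    edges p = [:: (c `+` rsrc beta, alpha); (c `+` rtgt alpha, beta)] /\
    edges q = [:: (c `+` rsrc alpha, beta); (c `+` rtgt beta, alpha)].

Definition cwrs_category : category := quotient cwrs_exchange.

End CommutativeReduction.

(* 2-polygraphs with exactly one 0-cell, whose 1-arrows are words in the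
   1-cells. *)
Record polygraph2 := Polygraph2 {
  cell1 : Type;
  cell2 : Type;
  psrc : cell2 -> seq cell1;
  ptgt : cell2 -> seq cell1
}.

Section PolygraphReduction.
Variable S : polygraph2.

(* The edge (u, phi, v) is the whiskering of phi by u on the left and by v on
   the right. *)
Definition polygraph_graph : graph :=
  @Graph (seq (cell1 S)) (seq (cell1 S) * cell2 S * seq (cell1 S))
    (fun e => let: (u, phi, v) := e in u ++ psrc phi ++ v)
    (fun e => let: (u, phi, v) := e in u ++ ptgt phi ++ v).

Definition polygraph_exchange : homrel (free_category polygraph_graph) :=
  fun a b p q => exists (phi psi : cell2 S) (u v w : seq (cell1 S)),
    edges p = [:: (u, phi, v ++ psrc psi ++ w);
                  (u ++ ptgt phi ++ v, psi, w)] /\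
    edges q = [:: (u ++ psrc phi ++ v, psi, w);
                  (u, phi, v ++ ptgt psi ++ w)].

(* The free 2-category, seen as the category of 1-arrows and 2-arrows. *)
Definition free_2category : category := quotient polygraph_exchange.

End PolygraphReduction.

Section Sigma2.
Variables (d : Order.disp_t) (X : orderType d) (R : cwrs X).

(* The word x_1 ^ n_1 ... x_k ^ n_k with x_1 < ... < x_k, for
   a = n_1 . x_1 + ... + n_k . x_k with all n_i >= 1. *)
Definition normal_word (a : {mset X}) : seq X :=
  flatten [seq nseq (a x) x | x <- sort <=%O (finsupp a)].

Inductive sigma2_cell :=
| Tau (x y : X) of x != y
| Rule of rule R.

Definition sigma2_src (phi : sigma2_cell) : seq X :=
  match phi with
  | Tau x y _ => [:: x; y]
  | Rule alpha => normal_word (rsrc alpha)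
  end.

Definition sigma2_tgt (phi : sigma2_cell) : seq X :=
  match phi with
  | Tau x y _ => [:: y; x]
  | Rule alpha => normal_word (rtgt alpha)
  end.

Definition Sigma2 : polygraph2 := Polygraph2 sigma2_src sigma2_tgt.

Fact seq_mset_cat (s t : seq X) :
  seq_mset (s ++ t) = seq_mset s `+` seq_mset t.
Proof. by apply/msetP => x; rewrite !(msetE2, mset_seqE) count_cat. Qed.

Fact seq_mset_normal_word a : seq_mset (normal_word a) = a.
Proof.
rewrite -[RHS]seq_mset_id; apply/eq_seq_msetP.
rewrite /normal_word EnumMset.E; apply: perm_flatten; apply: perm_map.
by rewrite perm_sort.
Qed.

Fact chain_tau u x y v :
  @chain (cwrs_graph R) (seq_mset (u ++ [:: x; y] ++ v)) [::]
    (seq_mset (u ++ [:: y; x] ++ v)).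
Proof.
by apply/eq_seq_msetP; rewrite perm_cat2l perm_cat2r (perm_catC [:: x] [:: y]).
Qed.

Fact chain_rule u (alpha : rule R) v :
  @chain (cwrs_graph R) (seq_mset (u ++ normal_word (rsrc alpha) ++ v))
    [:: (seq_mset u `+` seq_mset v, alpha)]
    (seq_mset (u ++ normal_word (rtgt alpha) ++ v)).
Proof.
by split=> /=; rewrite !seq_mset_cat seq_mset_normal_word -msetDA;
  rewrite [_ `+` seq_mset v]msetDC.
Qed.

(* An edge whiskering some [Tau] is sent to an empty path, i.e. an identity:
   its endpoints have the same projection. *)
Definition pi_edge (e : edge (polygraph_graph Sigma2)) :
  @gpath (cwrs_graph R) (seq_mset (gsrc e)) (seq_mset (gtgt e)) :=
  match e with
  | (u, Tau x y _, v) => exist _ [::] (chain_tau u x y v)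
  | (u, Rule alpha, v) =>
      exist _ [:: (seq_mset u `+` seq_mset v, alpha)] (chain_rule u alpha v)
  end.

Definition pi_functor :
  functor (free_category (polygraph_graph Sigma2))
          (free_category (cwrs_graph R)) :=
  @free_functor (polygraph_graph Sigma2) (cwrs_graph R) (@seq_mset X) pi_edge.

End Sigma2.

(* Main.v *)
(* A functor that identifies related arrows factors through the quotient
   category, so it suffices that pi sends both sides of each exchange relation
   of the polygraph to congruent paths.  If one of the two 2-cells is a
   permutation tau, the two images are the same path, as tau becomes an identity
   and swapping two letters of the context does not change its projection.
   If both are rules, the images are the two sides of the exchange relation of
   (X, R) with c = pi(u) + pi(v) + pi(w). *)

Require Import Defs.
From mathcomp Require Import all_boot all_order.
From mathcomp Require Import finmap multiset boolp.

Set Implicit Arguments.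
Unset Strict Implicit.
Unset Printing Implicit Defensive.

Local Open Scope mset_scope.

(** Sharing the object map of [F] lets arrow maps be compared without transport; the proofs of the
    functor laws agree by proof irrelevance. *)
Lemma functor_eqP (C D : category) (F : functor C D)
    (homG : forall a b, hom C a b -> hom D (F a) (F b)) idG compG :
  (forall a b (f : hom C a b), homG a b f = fhom F f) ->
  @Functor C D F homG idG compG = F.
Proof.
case: F homG idG compG => F0 F1 id1 comp1 /= homG idG compG eqG.
have eqF : homG = F1 by do 3!apply: functional_extensionality_dep => ?.
by subst homG; congr Functor; apply: Prop_irrelevance.
Qed.

Section QuotientUniversal.
Variables (C D : category) (r : homrel C) (F : functor C D).
Hypothesis F_r : forall a b (f g : hom C a b), r f g -> fhom F f = fhom F g.

Lemma fhom_congruence a b (f g : hom C a b) :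
  congruence r f g -> fhom F f = fhom F g.
Proof.
elim=> {a b f g} //; first by move=> a b f g h _ -> _ ->.
by move=> a b c f f' g g' _ eqf _ eqg; rewrite !fhom_comp eqf eqg.
Qed.

Lemma fhom_rep_class_of a b (f : hom C a b) :
  fhom F (rep (class_of r f)) = fhom F f.
Proof. exact/fhom_congruence/rep_class_of. Qed.

Lemma quotient_lift_id a : fhom F (rep (class_of r (idm a))) = idm (F a).
Proof. by rewrite fhom_rep_class_of fhom_id. Qed.

Lemma quotient_lift_comp a b c (p : quot_hom r a b) (q : quot_hom r b c) :
  fhom F (rep (quot_comp p q)) =
    Defs.comp (fhom F (rep p)) (fhom F (rep q)).
Proof. by rewrite fhom_rep_class_of fhom_comp. Qed.

(** A class is evaluated at its chosen representative; by [fhom_rep_class_of] any other one gives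
    the same value. *)
Definition quotient_lift : functor (quotient r) D :=
  @Functor (quotient r) D F (fun a b q => fhom F (rep q))
    quotient_lift_id quotient_lift_comp.

Lemma quotient_liftE : functor_comp (quotient_functor r) quotient_lift = F.
Proof. by apply: functor_eqP => a b f; apply: fhom_rep_class_of. Qed.

End QuotientUniversal.

Section Exchange.
Variables (d : Order.disp_t) (X : orderType d) (R : cwrs X).

Lemma seq_mset_tau (u v : seq X) x y :
  seq_mset (u ++ [:: x; y] ++ v) = seq_mset (u ++ [:: y; x] ++ v).
(* A chain along the empty list is by conversion an equality of its endpoints. *)
Proof. exact: (chain_tau R). Qed.

Lemma pi_exchange a b
    (p q : hom (free_category (polygraph_graph (Sigma2 R))) a b) :
  polygraph_exchange p q ->
  congruence (@cwrs_exchange X R)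
    (fhom (pi_functor R) p) (fhom (pi_functor R) q).
Proof.
case=> phi [psi [u [v [w [Ep Eq]]]]].
have [El|Er] : edges (fhom (pi_functor R) p) = edges (fhom (pi_functor R) q) \/
  cwrs_exchange (fhom (pi_functor R) p) (fhom (pi_functor R) q).
- rewrite /cwrs_exchange /edges /= /free_map Ep Eq.
  case: phi {Ep Eq} => [x y xy|alpha]; case: psi => [x' y' xy'|beta] /=.
  + by left.
  + by left; rewrite (seq_mset_tau u v x y).
  + by left; rewrite (seq_mset_tau v w x' y').
  + right; exists (seq_mset u `+` seq_mset v `+` seq_mset w), alpha, beta.
    rewrite !seq_mset_cat !seq_mset_normal_word.
    (* [movel] handles the edges of [alpha], where the side [m] of [beta] sits in the right context;
       [mover] those of [beta], where the side [m] of [alpha] sits in the left one. *)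
    have movel m : seq_mset u `+` (seq_mset v `+` (m `+` seq_mset w)) =
        seq_mset u `+` seq_mset v `+` seq_mset w `+` m.
      by rewrite -!msetDA [m `+` _]msetDC.
    have mover m : seq_mset u `+` (m `+` seq_mset v) `+` seq_mset w =
        seq_mset u `+` seq_mset v `+` seq_mset w `+` m.
      by rewrite -movel -!msetDA [m `+` _]msetDC -!msetDA [seq_mset w `+` m]msetDC.
    by rewrite !movel !mover.
- by rewrite (gpath_inj El); apply: Cong_refl.
- exact: Cong_gen.
Qed.

End Exchange.

Theorem proposition3p17 (d : Order.disp_t) (X : orderType d) (R : cwrs X) :
  exists pibar : functor (free_2category (Sigma2 R)) (cwrs_category R),
    functor_comp (quotient_functor (@polygraph_exchange (Sigma2 R))) pibar =
    functor_comp (pi_functor R) (quotient_functor (@cwrs_exchange X R)).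
Proof.
pose F := functor_comp (pi_functor R) (quotient_functor (@cwrs_exchange X R)).
have F_exchange a b
    (p q : hom (free_category (polygraph_graph (Sigma2 R))) a b) :
  polygraph_exchange p q -> fhom F p = fhom F q.
  (* [fhom F p] unfolds to the class of the image of [p], so congruent images suffice. *)
  by move=> pq; apply/class_ofP/pi_exchange.
by exists (quotient_lift F_exchange); apply: quotient_liftE.
Qed.
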